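(* The functions $M_I(\mathbb{Y})$, where $I$ runs over compositions whose last part is greater than $1$, form a linear basis of $\mathrm{Sol}'$.
   Context: Compositions are finite sequences of positive integers. $\mathbf{Sym}$ is the free associative algebra $\mathbb{C}\langle S_1,S_2,\dots\rangle$, $S_0=1$, $S^I=S_{i_1}\cdots S_{i_r}$ (these form a basis), $\sigma_t=\sum_{n\ge0}S_nt^n$, and $\phi_n\in\mathbf{Sym}$ are defined by $\log\sigma_t=\sum_{n\ge1}\phi_nt^n$. For $m\ge0$ and commuting variables $p_1,\dots,p_m,q_1,\dots,q_m$, set $q'_i=q_i+q_{i+1}+\dots+q_m$ and expand the ordered product $\prod_{i=1}^{m}\exp\!\big(p_i\sum_{n\ge1}\phi_n(q'_i)^{n-1}\big)$ (factors from left to right by increasing $i$; this is $\prod_i^{\rightarrow}\sigma_{q'_i}^{\,p_i/q'_i}$) as $\sum_I (M_I(\mathbb{Y}))_m\,S^I$ with $(M_I(\mathbb{Y}))_m\in\mathbb{C}[p_1,\dots,p_m,q_1,\dots,q_m]$; $M_I(\mathbb{Y})$ is the sequence $((M_I(\mathbb{Y}))_m)_{m\ge0}$. Stable polynomials in $\mathbf{p},\mathbf{q}$: $h=(h_m)_{m\ge0}$, $h_m\in\mathbb{C}[p_1,\dots,p_m,q_1,\dots,q_m]$, bounded degree, $h_{m+1}(p_1,\dots,p_m,0;q_1,\dots,q_m,0)=h_m$. $\mathrm{Sol}'$ is the set of such $h$ with, for all $m\ge1$, $1\le i\le m$: $h_m|_{q_i=0}=h_{m-1}(p_1,\dots,p_{i-1},p_i+p_{i+1},p_{i+2},\dots,p_m;q_1,\dots,q_{i-1},q_{i+1},\dots,q_m)$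 if $i<m$, $h_m|_{q_m=0}=h_{m-1}(p_1,\dots,p_{m-1};q_1,\dots,q_{m-1})$; $h_m|_{p_i=0}=h_{m-1}(p_1,\dots,p_{i-1},p_{i+1},\dots,p_m;q_1,\dots,q_{i-2},q_{i-1}+q_i,q_{i+1},\dots,q_m)$ if $i>1$, $h_m|_{p_1=0}=h_{m-1}(p_2,\dots,p_m;q_2,\dots,q_m)$. *)

(* Defs.v *)
From mathcomp Require Import all_boot all_order all_algebra.
From mathcomp Require Import reals complex mpoly.

Set Implicit Arguments.
Unset Strict Implicit.
Unset Printing Implicit Defensive.

Import GRing.Theory.
Local Open Scope ring_scope.

Definition is_composition (I : seq nat) : bool := all (leq 1) I.

(* The ordered product of exponentials lives in the completion of
   A (x) Sym, A commutative, i.e. in formal noncommutative series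
   \sum_I f_I S^I; a series is given by its coefficients on words
   I = [:: i_1; ...; i_r], S^I = S_{i_1} ... S_{i_r}.  As S^I S^J = S^(I ++ J),
   the product is the Cauchy product for concatenation.  Words with a letter 0
   are not compositions: every series built below vanishes on them. *)
Definition ncseries (A : Type) := seq nat -> A.

Section NCSeries.
Variables (K : fieldType) (A : lalgType K).
Implicit Types f g : ncseries A.

Definition nc1 : ncseries A := fun w => (nilp w)%:R.

Definition ncmul f g : ncseries A :=
  fun w => \sum_(0 <= k < (size w).+1) f (take k w) * g (drop k w).

Definition ncpow f k : ncseries A := iter k (ncmul f) nc1.

(* If f has no constant term then f^k vanishes on words of length < k (lemma
   [ncpow_small]), so the two sums below are the full series
   \sum_(k >= 0) f^k / k!  and  \sum_(k >= 1) (-1)^(k-1) (g - 1)^k / k. *)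
Definition ncexp f : ncseries A :=
  fun w => \sum_(0 <= k < (size w).+1) (k`!%:R^-1 : K) *: ncpow f k w.

Definition nclog g : ncseries A :=
  fun w => \sum_(1 <= k < (size w).+1)
    ((-1) ^+ k.-1 / k%:R : K) *: ncpow (fun u => g u - nc1 u) k w.

Lemma ncpow_small f k w :
  f [::] = 0 -> (size w < k)%N -> ncpow f k w = 0.
Proof.
move=> f0; elim: k w => [|k IHk] w //= lt_wk.
rewrite /ncmul big1_seq // => j /andP[_]; rewrite mem_index_iota ltnS => le_jw.
case: j le_jw => [|j] le_jw; first by rewrite take0 f0 mul0r.
rewrite IHk ?mulr0 // size_drop; apply: leq_trans (_ : size w <= k)%N => //.
by rewrite ltn_subrL; case: (size w) le_jw.
Qed.

End NCSeries.

Section Phi.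
Variable K : fieldType.

(* sigma_t, with t = 'X a central variable. *)
Definition sigma : ncseries {poly K} := fun w =>
  match w with
  | [::] => 1
  | [:: n] => if n == 0 then 0 else 'X^n
  | _ => 0
  end.

Definition phi (n : nat) : ncseries K := fun w => (nclog sigma w)`_n.

Lemma sigmaB1 w :
  exists c : K, sigma w - nc1 {poly K} w = c *: 'X^(sumn w).
Proof.
case: w => [|n [|n' w]]; rewrite /sigma /nc1 /=.
- by exists 0; rewrite subrr scale0r.
- rewrite addn0 subr0; case: eqP => _; [exists 0 | exists 1];
  by rewrite ?scale0r ?scale1r.
by exists 0; rewrite subrr scale0r.
Qed.

(* phi_n is homogeneous of weight n. *)
Lemma phi_weight n w : sumn w != n -> phi n w = 0.
Proof.
move=> neq_wn; rewrite /phi /nclog coef_sum big1 // => k _.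
suff [c ->] : exists c : K,
    ncpow (fun u => sigma u - nc1 {poly K} u) k w = c *: 'X^(sumn w).
  by rewrite !coefZ coefXn eq_sym (negPf neq_wn) !mulr0.
elim: k w {neq_wn} => [|k IHk] w.
  rewrite /= /nc1; case: w => [|a w] /=.
    by exists 1; rewrite expr0 scale1r.
  by exists 0; rewrite scale0r.
rewrite /= /ncmul; elim/big_rec: _ => [|j p _ [c ->]].
  by exists 0; rewrite scale0r.
have [a ->] := sigmaB1 (take j w); have [b ->] := IHk (drop j w).
exists (a * b + c); rewrite scalerDl; congr (_ + _).
by rewrite -scalerAl -scalerAr scalerA -exprD -sumn_cat cat_take_drop.
Qed.

End Phi.

(* C[p_1..p_m, q_1..q_m]; i : 'I_m is the 1-based index i + 1. *)
Notation pqpoly K m := {mpoly K[(m + m)%N]}.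

Section StablePolynomials.
Variable K : fieldType.

Definition pvar m (i : 'I_m) : pqpoly K m := 'X_(lshift m i).
Definition qvar m (i : 'I_m) : pqpoly K m := 'X_(rshift m i).

(* h(P_1, ..., P_k; Q_1, ..., Q_k) *)
Definition pqsubst k m (h : pqpoly K k) (P Q : 'I_k -> pqpoly K m) :
    pqpoly K m :=
  h \mPo [tuple match split j with inl i => P i | inr i => Q i end | j < k + k].

Definition qtail m (i : 'I_m) : pqpoly K m := \sum_(j < m | (i <= j)%N) qvar j.

(* exp (p_i \sum_(n >= 1) phi_n q'_i^(n-1)); by [phi_weight], only n = sumn w
   contributes to the coefficient of S^w, so the finite sum is the full one. *)
Definition expfactor m (i : 'I_m) : ncseries (pqpoly K m) :=
  ncexp (K := K) (fun w =>
    pvar i * \sum_(1 <= n < (sumn w).+1) phi K n w *: qtail i ^+ n.-1).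

(* \big folds to the right, so the factors are multiplied in the order of
   increasing i. *)
Definition MY (I : seq nat) (m : nat) : pqpoly K m :=
  (\big[@ncmul K (pqpoly K m)/nc1 (pqpoly K m)]_(i < m) expfactor i) I.

Definition pqseq := forall m : nat, pqpoly K m.

(* [msize] is the total degree plus one. *)
Definition stable (h : pqseq) : Prop :=
  (exists d : nat, forall m, (msize (h m) <= d)%N) /\
  (forall m : nat,
     pqsubst (h m.+1)
       (fun j => if unlift ord_max j is Some k then pvar k else 0)
       (fun j => if unlift ord_max j is Some k then qvar k else 0)
     = h m).

(* In [Solq] (resp. [Solp]) the extra summand occurs in at most one place: it
   turns p_{i+1} into p_i + p_{i+1} (resp. q_{i-1} into q_{i-1} + q_i), and is
   absent when i is the last (resp. first) index. *)
Definition Solq (h : pqseq) : Prop :=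
  forall (n : nat) (i : 'I_n.+1),
    pqsubst (h n.+1) (@pvar n.+1) (fun j => if j == i then 0 else qvar j)
    = pqsubst (h n)
        (fun k => (if k == i :> nat then pvar i else 0) + pvar (lift i k))
        (fun k => qvar (lift i k)).

Definition Solp (h : pqseq) : Prop :=
  forall (n : nat) (i : 'I_n.+1),
    pqsubst (h n.+1) (fun j => if j == i then 0 else pvar j) (@qvar n.+1)
    = pqsubst (h n)
        (fun k => pvar (lift i k))
        (fun k => qvar (lift i k) + (if k.+1 == i :> nat then qvar i else 0)).

Definition Sol' (h : pqseq) : Prop := [/\ stable h, Solq h & Solp h].

(* The family (b j), j in J, is a linear basis of the subspace W of pqseq
   (with its componentwise operations): linearly independent, with span W. *)
Definition linear_basis (T : eqType) (J : pred T) (b : T -> pqseq)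
    (W : pqseq -> Prop) : Prop :=
  (forall (s : seq T) (c : T -> K), uniq s -> all J s ->
     (forall m, \sum_(j <- s) c j *: b j m = 0) ->
     forall j, j \in s -> c j = 0) /\
  (forall h : pqseq, W h <->
     exists (s : seq T) (c : T -> K), all J s /\
       forall m, h m = \sum_(j <- s) c j *: b j m).

End StablePolynomials.

(* Compositions whose last part, if any, is greater than 1: the empty
   composition is included, M_[::] being the constant sequence 1, which lies
   in Sol' and is not in the span of the others. *)
Definition last_part_gt1 (I : seq nat) : bool :=
  is_composition I && (1 < last 2 I)%N.

(* Main.v *)
(* For a composition J = (j_1, ..., j_r) let L_J(h) be the coefficient of
   p_1 ... p_r q_1^(j_1 - 1) ... q_r^(j_r - 1) in h_r.  The L_J with last part
   greater than 1 separate the points of Sol': the equation for q_i = 0 expresses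
   the coefficient of a monomial with p_i^a, a > 1, through that of the monomial
   in which this power is split as p_i p_(i+1)^(a - 1), so all coefficients of
   monomials involving every p_i reduce to the L_J, and the equation for p_i = 0
   gives the remaining ones by induction on m.  On the other hand the matrix of
   the L_J(M_I) is unitriangular: M_I is homogeneous of degree |I|; in the
   product of r exponentials the coefficient of S^I has no term containing all of
   p_1, ..., p_r if I has less than r parts, and if it has r parts this term is
   \prod_k p_k q'_k^(i_k - 1), whose leading monomial is that of L_I.  Since the
   M_I are in Sol', they form a basis. *)

Require Import Defs.
From HB Require Import structures.
From mathcomp Require Import all_boot all_order all_algebra.
From mathcomp Require Import reals complex mpoly boolp.

Set Implicit Arguments.
Unset Strict Implicit.
Unset Printing Implicit Defensive.

Import Order.TTheory GRing.Theory Num.Theory.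
Import Order.DefaultSeqLexiOrder.
Local Open Scope ring_scope.

(** * Noncommutative series *)

Section NCMonoid.
Variables (K : fieldType) (A : lalgType K).
Implicit Types f g h : ncseries A.

Lemma ncmul_nil f g : ncmul f g [::] = f [::] * g [::].
Proof. by rewrite /ncmul /= big_nat1. Qed.

Lemma ncmul_cons f g a w :
  ncmul f g (a :: w) = f [::] * g (a :: w) + ncmul (fun u => f (a :: u)) g w.
Proof.
by rewrite /ncmul big_nat_recl //; congr (_ + _); apply: eq_bigr => i _.
Qed.

Lemma ncmulDl f f' g w :
  ncmul (fun u => f u + f' u) g w = ncmul f g w + ncmul f' g w.
Proof.
by rewrite /ncmul -big_split; apply: eq_bigr => i _; rewrite mulrDl.
Qed.

Lemma ncmulZl (c : A) f g w : ncmul (fun u => c * f u) g w = c * ncmul f g w.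
Proof.
by rewrite /ncmul mulr_sumr; apply: eq_bigr => i _; rewrite mulrA.
Qed.

(** Induction on the word: [ncmul_cons] removes the first letter at the cost of replacing [f] by
    [fun u => f (a :: u)], hence the generalization over [f]. *)
Lemma ncmulA : associative (@ncmul K A).
Proof.
move=> f g h; apply/funext => w; elim: w f => [|a w IHw] f.
  by rewrite !ncmul_nil mulrA.
rewrite !ncmul_cons IHw mulrDr mulrA -addrA ncmul_nil; congr (_ + _).
have -> : (fun u => ncmul f g (a :: u)) =
    (fun u => f [::] * g (a :: u) + ncmul (fun v => f (a :: v)) g u).
  by apply/funext => u; rewrite ncmul_cons.
by rewrite ncmulDl ncmulZl.
Qed.

Lemma ncmul1l : left_id (nc1 A) (@ncmul K A).
Proof.
move=> f; apply/funext => -[|a w]; first by rewrite ncmul_nil mul1r.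
rewrite ncmul_cons mul1r /ncmul big1 ?addr0 // => i _.
by rewrite /nc1 /= mul0r.
Qed.

Lemma ncmul1r : right_id (nc1 A) (@ncmul K A).
Proof.
move=> f; apply/funext => w; rewrite /ncmul big_nat_recr //= take_size drop_size.
rewrite mulr1 big1_seq ?add0r // => i; rewrite mem_index_iota => /andP[_ /= lt_iw].
by rewrite /nc1 /nilp size_drop subn_eq0 leqNgt lt_iw mulr0.
Qed.

HB.instance Definition _ :=
  Monoid.isLaw.Build (ncseries A) (nc1 A) (@ncmul K A) ncmulA ncmul1l ncmul1r.

Lemma ncpow1 f : ncpow (K := K) f 1 = f.
Proof. exact: ncmul1r. Qed.

Lemma ncpowD f k l : ncpow (K := K) f (k + l) = ncmul (ncpow f k) (ncpow f l).
Proof. by elim: k => [|k IHk]; rewrite ?ncmul1l //= IHk ncmulA. Qed.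

Lemma ncexp_nil f : ncexp f [::] = 1.
Proof. by rewrite /ncexp /= big_nat1 fact0 invr1 scale1r. Qed.

(** A truncation bound that does not depend on the word lets the exponentials of a prefix and of a
    suffix be multiplied termwise. *)
Lemma ncexp_widen f n w : f [::] = 0 -> (size w < n)%N ->
  ncexp f w = \sum_(0 <= k < n) (k`!%:R^-1 : K) *: ncpow f k w.
Proof.
move=> f0 lt_wn; rewrite /ncexp [RHS](big_cat_nat (n := (size w).+1)) //=.
rewrite [X in _ = _ + X]big1_seq ?addr0 // => k.
by rewrite mem_index_iota => /andP[_ /andP[lt_wk _]]; rewrite ncpow_small ?scaler0.
Qed.

End NCMonoid.

Section NCMorphism.
Variables (K : fieldType) (A B : lalgType K) (F : {lrmorphism A -> B}).
Implicit Types f g : ncseries A.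

Lemma rmorph_ncmul f g w : F (ncmul f g w) = ncmul (F \o f) (F \o g) w.
Proof. by rewrite /ncmul rmorph_sum; apply: eq_bigr => i _; rewrite rmorphM. Qed.

Lemma rmorph_ncpow f k w : F (ncpow f k w) = ncpow (F \o f) k w.
Proof.
elim: k w => [|k IHk] w /=; first by rewrite /nc1 rmorph_nat.
by rewrite rmorph_ncmul; apply: eq_bigr => i _; rewrite /= IHk.
Qed.

Lemma rmorph_ncexp f w : F (ncexp f w) = ncexp (F \o f) w.
Proof.
by rewrite /ncexp linear_sum; apply: eq_bigr => i _; rewrite linearZ /= rmorph_ncpow.
Qed.

Lemma rmorph_ncprod (I : Type) (r : seq I) (f : I -> ncseries A) w :
  F ((\big[@ncmul K A/nc1 A]_(i <- r) f i) w) =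
  (\big[@ncmul K B/nc1 B]_(i <- r) (F \o f i)) w.
Proof.
elim: r w => [|i r IHr] w; first by rewrite !big_nil /nc1 rmorph_nat.
by rewrite !big_cons rmorph_ncmul; apply: eq_bigr => j _; rewrite /= IHr.
Qed.

End NCMorphism.

(** * Ordered products with one index singled out *)

Section ProductInsertion.
Variables (T : Type) (idx : T) (op : Monoid.law idx).

(** Without commutativity the factor at [i] must keep its place: it is attached to the left of its
    successor, which is [lift i k] for [k = i], or put at the end when [i] is last. The shape
    matches the equations of [Solq]. *)
Lemma big_ord_lift n (i : 'I_n.+1) (f : 'I_n.+1 -> T) :
  \big[op/idx]_(j < n.+1) f j =
  op (\big[op/idx]_(k < n) op (if k == i :> nat then f i else idx) (f (lift i k)))
     (if n == i :> nat then f i else idx).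
Proof.
elim: n i f => [|n IHn] i f.
  by rewrite big_ord_recl !big_ord0 Monoid.mulm1 Monoid.mul1m (ord1 i).
case: (unliftP ord0 i) => [i' ->|->]; last first.
  rewrite big_ord_recl /= Monoid.mulm1 [in RHS]big_ord_recl /= -Monoid.mulmA.
  congr (op _ _); rewrite big_ord_recl; congr (op _ _).
  apply: eq_bigr => j _.
  by rewrite /= Monoid.mul1m; congr (f _); apply: val_inj.
rewrite big_ord_recl (IHn i') [in RHS]big_ord_recl /= Monoid.mul1m -Monoid.mulmA.
congr (op (f _) (op _ _)); first exact: val_inj.
apply: eq_bigr => k _; congr (op _ (f _)); apply: val_inj.
by rewrite /= /bump /= !add1n ltnS addnS.
Qed.

End ProductInsertion.
Arguments big_ord_lift {T idx op n}.

(** * The exponentials of [x * \sum_n phi_n y^(n-1)] *)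

Section ExpPhi.
Variables (K : numFieldType) (A : comAlgType K).
Implicit Types (x y : A) (w : seq nat).

Definition phiseries y : ncseries A :=
  fun w => \sum_(1 <= n < (sumn w).+1) phi K n w *: y ^+ n.-1.

(** This is [sigma_y^(x/y)] in a form that makes sense at [y = 0]; [expfactor i] is its instance at
    [x = p_i], [y = q'_i]. *)
Definition expphi x y : ncseries A := ncexp (fun w => x * phiseries y w).

Lemma phiseriesE y w : phiseries y w =
  if sumn w == 0%N then 0 else phi K (sumn w) w *: y ^+ (sumn w).-1.
Proof.
rewrite /phiseries; case: eqP => [->|/eqP]; first by rewrite big_geq.
rewrite -lt0n => w_gt0; rewrite big_nat_recr //= big1_seq ?add0r // => n.
rewrite mem_index_iota => /andP[_ /andP[_ lt_nw]].
by rewrite phi_weight ?scale0r // gtn_eqF.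
Qed.

(** On a word of length one only the linear term of the logarithm contributes. *)
Lemma phi_letter n : (0 < n)%N -> phi K n [:: n] = 1.
Proof.
move=> n_gt0; rewrite /phi /nclog /= big_nat1 expr0 divr1 scale1r.
rewrite ncpow1 /= gtn_eqF // /nc1 /= subr0 coefXn eqxx.
by [].
Qed.

Lemma ncpow_scale x (f : ncseries A) k w :
  ncpow (K := K) (fun u => x * f u) k w = x ^+ k * ncpow f k w.
Proof.
elim: k w => [|k IHk] w /=; first by rewrite mul1r.
rewrite /ncmul mulr_sumr; apply: eq_bigr => j _.
by rewrite IHk exprS !mulrA; congr (_ * _); rewrite -!mulrA; congr (_ * _); rewrite mulrC.
Qed.

Lemma expphiE x y n w : (size w < n)%N ->
  expphi x y w =
  \sum_(k < n) (k`!%:R^-1 *: x ^+ k) * ncpow (K := K) (phiseries y) k w.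
Proof.
move=> lt_wn; rewrite /expphi (ncexp_widen _ lt_wn) ?phiseriesE ?mulr0 //.
rewrite big_mkord; apply: eq_bigr => k _.
by rewrite ncpow_scale scalerAl.
Qed.

Lemma expphi_nil x y : expphi x y [::] = 1.
Proof. exact: ncexp_nil. Qed.

Lemma expphi_letter x y a : (0 < a)%N -> expphi x y [:: a] = x * y ^+ a.-1.
Proof.
move=> a_gt0; rewrite (@expphiE _ _ 2) // 2!big_ord_recl big_ord0 addr0.
rewrite ncpow1 /= /nc1 mulr0 add0r phiseriesE /= addn0 gtn_eqF //.
by rewrite phi_letter // scale1r expr1 factS fact0 invr1 scale1r.
Qed.

Lemma expphi0 y : expphi 0 y = nc1 A.
Proof.
apply/funext => w; rewrite (@expphiE _ _ (size w).+1) // big_ord_recl.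
rewrite expr0 fact0 invr1 scale1r mul1r big1 ?addr0 // => k _.
by rewrite /= expr0n scaler0 mul0r.
Qed.

(** Both exponents are multiples of one series, whose powers commute, so the binomial argument
    applies despite noncommutativity. *)
Lemma expphiD x x' y :
  ncmul (K := K) (expphi x y) (expphi x' y) = expphi (x + x') y.
Proof.
apply/funext => w; set n := (size w).+1; set f := phiseries y.
pose G k l := (k`!%:R^-1 *: x ^+ k) * (l`!%:R^-1 *: x' ^+ l) *
              ncpow (K := K) f (k + l) w.
have f0 : f [::] = 0 by rewrite /f phiseriesE.
have G0 k l : (n <= k + l)%N -> G k l = 0.
  by move=> le_nkl; rewrite /G ncpow_small // mulr0.
transitivity (\sum_(k < n) \sum_(l < n) G k l).
  transitivity (\sum_(0 <= j < n) \sum_(k < n) \sum_(l < n)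
     ((k`!%:R^-1 *: x ^+ k) * (l`!%:R^-1 *: x' ^+ l)) *
     (ncpow (K := K) f k (take j w) * ncpow (K := K) f l (drop j w))).
    apply: eq_bigr => j _; rewrite !(@expphiE _ _ n); first last.
    - by rewrite ltnS size_take_min geq_minr.
    - by rewrite ltnS size_drop leq_subr.
    rewrite big_distrlr; apply: eq_bigr => k _; apply: eq_bigr => l _.
    by rewrite /= mulrACA.
  rewrite exchange_big; apply: eq_bigr => k _ /=.
  rewrite exchange_big; apply: eq_bigr => l _ /=.
  by rewrite -mulr_sumr /G ncpowD.
rewrite (@expphiE _ _ n) //.
(* Reindexing by [s = k + l]; the terms of the square with [k + l >= n] vanish by [G0]. *)
transitivity (\sum_(k < n) \sum_(s < n | (k <= s)%N) G k (s - k)%N).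
  apply: eq_bigr => k _; rewrite -(big_mkord xpredT).
  have -> : \sum_(s < n | (k <= s)%N) G k (s - k)%N =
            \sum_(0 + k <= s < n) G k (s - k)%N by rewrite add0n big_geq_mkord.
  rewrite big_addn.
  rewrite (big_cat_nat (n := (n - k)%N)) //= ?leq_subr //.
  rewrite [X in _ + X]big1_seq ?addr0 => [|l]; last first.
    rewrite mem_index_iota => /andP[_ /andP[le_nkl _]].
    by apply: G0; rewrite -leq_subLR.
  by apply: eq_bigr => l _; rewrite addnK.
rewrite (exchange_big_dep xpredT) //=; apply: eq_bigr => s _.
rewrite addrC exprDn scaler_sumr mulr_suml [RHS](big_ord_widen n (fun k =>
  s`!%:R^-1 *: (x' ^+ (s - k) * x ^+ k *+ 'C(s, k)) *
  ncpow (K := K) (phiseries y) s w)) //.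
apply: eq_big => k //; rewrite ?ltnS // => le_ks.
rewrite /G subnKC // -/f; congr (_ * _).
rewrite -scaler_nat scalerA -scalerAl -scalerAr scalerA [_ * x ^+ _]mulrC.
(* [1/(k! (s-k)!) = C(s,k)/s!], by characteristic zero. *)
congr (_ *: _); rewrite -(bin_fact le_ks) !natrM.
have nz m : m`!%:R != 0 :> K by rewrite pnatr_eq0 -lt0n fact_gt0.
have nzC : ('C(s, k))%:R != 0 :> K by rewrite pnatr_eq0 -lt0n bin_gt0.
by rewrite invfM mulrAC mulVf // mul1r invfM.
Qed.

(* [phi_1 = S_1], so [expphi x 0] involves only the words [S_1^k]. *)
Lemma expphi_y0 x w : w != [::] -> (1 < last 2 w)%N -> expphi x 0 w = 0.
Proof.
have f0 u : u != [::] -> (1 < last 2 u)%N -> phiseries (0 : A) u = 0.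
  elim/last_ind: u => // u a _ _; rewrite last_rcons => a_gt1.
  rewrite phiseriesE sumn_rcons; case: eqP => // _.
  (* The weight is at least 2, so 0 is raised to a positive power. *)
  case: (sumn u + a)%N (leq_trans a_gt1 (leq_addl (sumn u) a)) => [|[|m]] //= _.
  by rewrite expr0n scaler0.
have fk0 k u : u != [::] -> (1 < last 2 u)%N ->
    ncpow (K := K) (phiseries (0 : A)) k u = 0.
  elim: k u => [|k IHk] u u_neq0 lastu /=; first by rewrite /nc1; case: u u_neq0 {lastu}.
  rewrite /ncmul big1_seq // => j; rewrite mem_index_iota => /andP[_ /= le_ju].
  have [dn|dn] := eqVneq (drop j u) [::].
    by have := cat_take_drop j u; rewrite dn cats0 => ->; rewrite f0 ?mul0r.
  rewrite IHk ?mulr0 //; move: lastu; rewrite -{1}(cat_take_drop j u) last_cat.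
  by case: (drop j u) dn.
move=> w_neq0 lastw; rewrite (@expphiE _ _ (size w).+1) // big1 // => k _.
by rewrite fk0 // mulr0.
Qed.

(** Every nonempty suffix of [w] ends with the same letter greater than 1, so [expphi x 0] vanishes
    on it. This is where the condition on the last part enters. *)
Lemma ncmul_expphi_y0 (f : ncseries A) x w : (1 < last 2 w)%N ->
  ncmul (K := K) f (expphi x 0) w = f w.
Proof.
move=> lastw; rewrite /ncmul big_nat_recr //= take_size drop_size expphi_nil mulr1.
rewrite big1_seq ?add0r // => j; rewrite mem_index_iota => /andP[_ /= lt_jw].
have dn : drop j w != [::] by rewrite -size_eq0 size_drop subn_eq0 -ltnNge.
rewrite expphi_y0 ?mulr0 //; move: lastw; rewrite -{1}(cat_take_drop j w) last_cat.
by case: (drop j w) dn.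
Qed.

End ExpPhi.

Lemma rmorph_expphi (K : numFieldType) (A B : comAlgType K)
    (F : {lrmorphism A -> B}) (x y : A) w :
  F (expphi x y w) = expphi (F x) (F y) w.
Proof.
rewrite rmorph_ncexp; congr (ncexp _ w); apply/funext => u /=.
have <- : F (phiseries y u) = phiseries (F y) u.
  by rewrite /phiseries linear_sum; apply: eq_bigr => n _; rewrite linearZ /= rmorphXn.
exact: rmorphM.
Qed.

(** * The functions [M_I] lie in [Sol'] *)

Section Substitution.
Variable K : numFieldType.

Lemma pqsubst_pvar k m (P Q : 'I_k -> pqpoly K m) i :
  pqsubst (pvar K i) P Q = P i.
Proof.
rewrite /pqsubst /pvar comp_mpolyXU -tnth_nth tnth_mktuple.
by rewrite (unsplitK (inl i)).
Qed.

Lemma pqsubst_qvar k m (P Q : 'I_k -> pqpoly K m) i :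
  pqsubst (qvar K i) P Q = Q i.
Proof.
rewrite /pqsubst /qvar comp_mpolyXU -tnth_nth tnth_mktuple.
by rewrite (unsplitK (inr i)).
Qed.

Lemma pqsubst_MY I k m (P Q : 'I_k -> pqpoly K m) :
  pqsubst (MY K I k) P Q =
  (\big[@ncmul K (pqpoly K m)/nc1 (pqpoly K m)]_(i < k)
     expphi (P i) (\sum_(j < k | (i <= j)%N) Q j)) I.
Proof.
rewrite /pqsubst /MY rmorph_ncprod; congr (_ I); apply: eq_bigr => i _.
apply/funext => w; rewrite /= [LHS]rmorph_expphi.
congr (expphi _ _ w); first exact: pqsubst_pvar.
rewrite /qtail linear_sum; apply: eq_bigr => j _.
exact: pqsubst_qvar.
Qed.

(** [lift i k] lies before [i] exactly when [k < i]; only these tails contain the term at [i]. *)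
Lemma sum_tail_lift (V : nmodType) n (i : 'I_n.+1) (k : 'I_n) (F : 'I_n.+1 -> V) :
  \sum_(l < n.+1 | (lift i k <= l)%N) F l =
  (if (k < i)%N then F i else 0) + \sum_(l < n | (k <= l)%N) F (lift i l).
Proof.
have ltE : (lift i k <= i)%N = (k < i)%N.
  rewrite /= /bump; case: (leqP i k) => [le_ik|]; last exact: ltnW.
  by rewrite add1n ltnNge le_ik.
have lfE (l : 'I_n) : (lift i k <= lift i l)%N = (k <= l)%N by rewrite leq_bump2.
case: ifP => ki.
  by rewrite (@bigD1_ord _ _ _ _ i) ?ltE //; under eq_bigl do rewrite lfE.
rewrite add0r big_mkcond (@bigD1_ord _ _ _ _ i) //= -/(lift i k) ltE ki add0r -big_mkcond.
by under eq_bigl do rewrite lfE.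
Qed.

Lemma sum_tail_at (V : nmodType) n (i : 'I_n.+1) (F : 'I_n.+1 -> V) :
  \sum_(l < n.+1 | (i <= l)%N) F l = F i + \sum_(l < n | (i <= l)%N) F (lift i l).
Proof.
rewrite (@bigD1_ord _ _ _ _ i) //; congr (_ + _); apply: eq_bigl => l.
by rewrite /= /bump; case: (leqP i l) => [/leqW|]; rewrite ?add1n ?add0n // => /ltn_geF.
Qed.

(** Setting [q_i = 0] makes [q'_i = q'_(i+1)], so the factors [i] and [i+1] merge by [expphiD]. For
    the last [i], [q'_i] becomes 0 and [ncmul_expphi_y0] discards the factor. *)
Lemma Solq_MY I : (1 < last 2 I)%N -> Solq (MY K I).
Proof.
move=> lastI n i; rewrite !pqsubst_MY (big_ord_lift i).
have Y0 : \sum_(l < n.+1 | (i <= l)%N) (if l == i then 0 else qvar K l) =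
    \sum_(l < n | (i <= l)%N) qvar K (lift i l).
  rewrite sum_tail_at eqxx add0r; apply: eq_bigr => l _.
  by rewrite eq_sym (negPf (neq_lift i l)).
have last_factor : forall f : ncseries (pqpoly K n.+1),
   ncmul f (if n == i then expphi (pvar K i)
      (\sum_(j < n.+1 | (i <= j)%N) (if j == i then 0 else qvar K j))
      else nc1 (pqpoly K n.+1)) I = f I.
  move=> f; case: eqP => [eq_ni|_]; last by rewrite ncmul1r.
  rewrite Y0 big_pred0 ?ncmul_expphi_y0 // => l.
  by rewrite -eq_ni leqNgt ltn_ord.
rewrite [LHS]last_factor; congr (_ I); apply: eq_bigr => k _.
rewrite sum_tail_lift eqxx if_same add0r.
have -> : \sum_(l < n | (k <= l)%N) (if lift i l == i then 0 else qvar K (lift i l))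
    = \sum_(l < n | (k <= l)%N) qvar K (lift i l).
  by apply: eq_bigr => l _; rewrite eq_sym (negPf (neq_lift i l)).
case: eqP => [ki|_]; last by rewrite Monoid.mul1m add0r.
by rewrite Y0 -ki [LHS]expphiD.
Qed.

(** Setting [p_i = 0] makes the factor [i] trivial; [q_i] survives in the tails of the earlier
    factors, all of which contain [q_(i-1)] as well. *)
Lemma Solp_MY I : Solp (MY K I).
Proof.
move=> n i; rewrite !pqsubst_MY (big_ord_lift i) eqxx expphi0 if_same Monoid.mulm1.
congr (_ I); apply: eq_bigr => k _; rewrite if_same Monoid.mul1m.
rewrite eq_sym (negPf (neq_lift i k)); congr expphi.
rewrite sum_tail_lift big_split addrC /=; congr (_ + _).
rewrite -big_mkcondr /=; case: ifP => ki.
  (* [i.-1] is the index whose variable absorbs [q_i]. *)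
  have ip : (i.-1 < n)%N by rewrite -ltnS prednK ?(leq_ltn_trans _ ki).
  have iP : (i.-1.+1 = i) by rewrite prednK // (leq_ltn_trans _ ki).
  rewrite (big_pred1 (Ordinal ip)) // => l.
  rewrite -[RHS]/(nat_of_ord l == i.-1) -[RHS]eqSS iP andbC.
  by case: eqP => //= li; rewrite -ltnS li.
rewrite big_pred0 // => l; apply/negP => /andP[kl /eqP li].
by rewrite -li ltnS kl in ki.
Qed.

Lemma MY_cut I m :
  pqsubst (MY K I m.+1)
    (fun j => if unlift ord_max j is Some k then pvar K k else 0)
    (fun j => if unlift ord_max j is Some k then qvar K k else 0) = MY K I m.
Proof.
rewrite pqsubst_MY (big_ord_lift ord_max) unlift_none expphi0 if_same Monoid.mulm1.
congr (_ I); apply: eq_bigr => k _; rewrite if_same Monoid.mul1m liftK.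
congr expphi; rewrite sum_tail_lift unlift_none if_same add0r.
by apply: eq_bigr => l _; rewrite liftK.
Qed.

(** Each [phi_n], of weight [n], comes with [x * y^(n-1)], of degree [n]. *)
Lemma expphi_dhomog m (x y : pqpoly K m) w :
  x \is 1.-homog -> y \is 1.-homog -> expphi x y w \is (sumn w).-homog.
Proof.
move=> hx hy; rewrite (@expphiE _ _ _ _ (size w).+1) // rpred_sum // => k _.
rewrite -scalerAl rpredZ // -ncpow_scale; move: (k : nat) => {}k.
elim: k w => [|l IHl] w /=.
  by rewrite /nc1; case: w => [|a w]; rewrite ?dhomog1 ?dhomog0.
rewrite /ncmul rpred_sum // => j _; rewrite -[w in sumn w](cat_take_drop j w) sumn_cat.
apply: dhomogM => //; rewrite phiseriesE; case: eqP => [_|/eqP].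
  by rewrite mulr0 dhomog0.
rewrite -lt0n => w_gt0.
have := dhomogMn (sumn (take j w)).-1 hy; rewrite mul1n => hyn.
have := dhomogM hx (rpredZ (phi K (sumn (take j w)) (take j w)) hyn).
by rewrite add1n prednK.
Qed.

Lemma MY_dhomog I m : MY K I m \is (sumn I).-homog.
Proof.
rewrite /MY; elim: (index_enum _) I => [|i s IHs] w.
  by rewrite big_nil /nc1; case: w => [|a w]; rewrite ?dhomog1 ?dhomog0.
rewrite big_cons /ncmul rpred_sum // => j _; rewrite -[w in sumn w](cat_take_drop j w) sumn_cat.
apply: dhomogM => //; apply: expphi_dhomog.
  by rewrite dhomogX /= mdeg1.
by rewrite rpred_sum // => l _; rewrite dhomogX /= mdeg1.
Qed.

Lemma Sol'_MY I : (1 < last 2 I)%N -> Sol' (MY K I).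
Proof.
move=> lastI; split; [split; last exact: MY_cut | exact: Solq_MY | exact: Solp_MY].
exists (sumn I).+1 => m; rewrite msizeE; apply/bigmax_leqP_seq => u u_supp _.
by rewrite ltnS (dhomogP _ _ _ (MY_dhomog I m) u u_supp).
Qed.

End Substitution.

(** * Coefficients of elements of [Sol'] *)

Section Coefficients.
Variable K : numFieldType.

Lemma mcoeff_kill n (g : {mpoly K[n]}) x (u : 'X_{1..n}) : u x = 0%N ->
  (g \mPo [tuple if j == x then 0 else 'X_j | j < n])@_u = g@_u.
Proof.
move=> ux; rewrite [in RHS](mpolyE g) comp_mpolyEX !raddf_sum /=.
apply: eq_bigr => v _; rewrite !mcoeffZ comp_mpolyX; congr (_ * _).
have [vx|vx] := eqVneq (v x) 0%N.
  rewrite [in RHS]mpolyXE_id; congr (_@_u); apply: eq_bigr => j _.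
  by rewrite tnth_mktuple; case: eqP => // ->; rewrite vx.
rewrite (bigD1 x) //= tnth_mktuple eqxx expr0n (negPf vx) mul0r mcoeff0 mcoeffX.
by case: eqP => // vu; rewrite vu ux in vx.
Qed.

Lemma pqsubst_q0 m (g : pqpoly K m) i : pqsubst g (@pvar K m)
    (fun j => if j == i then 0 else qvar K j) =
  g \mPo [tuple if j == rshift m i then 0 else 'X_j | j < m + m].
Proof.
congr (g \mPo _); apply: eq_from_tnth => j; rewrite !tnth_mktuple.
by case: (split_ordP j) => k ->; rewrite ?eq_lrshift ?eq_rshift.
Qed.

Lemma pqsubst_p0 m (g : pqpoly K m) i : pqsubst g
    (fun j => if j == i then 0 else pvar K j) (@qvar K m) =
  g \mPo [tuple if j == lshift m i then 0 else 'X_j | j < m + m].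
Proof.
congr (g \mPo _); apply: eq_from_tnth => j; rewrite !tnth_mktuple.
by case: (split_ordP j) => k ->; rewrite ?eq_rlshift ?eq_lshift.
Qed.

Definition pqmnm m (a b : 'I_m -> nat) : 'X_{1..m + m} :=
  [multinom match split j with inl i => a i | inr i => b i end | j < m + m].

Lemma pqmnmEl m (a b : 'I_m -> nat) i : pqmnm a b (lshift m i) = a i.
Proof. by rewrite mnmE (unsplitK (inl i)). Qed.

Lemma pqmnmEr m (a b : 'I_m -> nat) i : pqmnm a b (rshift m i) = b i.
Proof. by rewrite mnmE (unsplitK (inr i)). Qed.

Lemma pqmnmP m (u v : 'X_{1..m + m}) :
  (forall i, u (lshift m i) = v (lshift m i)) ->
  (forall i, u (rshift m i) = v (rshift m i)) -> u = v.
Proof. by move=> eql eqr; apply/mnmP => j; case: (split_ordP j) => k ->. Qed.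

Definition liftmnm n (i : 'I_n.+1) (u : 'X_{1..n + n}) : 'X_{1..n.+1 + n.+1} :=
  pqmnm (fun j => oapp (fun k => u (lshift n k)) 0%N (unlift i j))
        (fun j => oapp (fun k => u (rshift n k)) 0%N (unlift i j)).

Lemma mpolyX_lift n (i : 'I_n.+1) (u : 'X_{1..n + n}) :
  'X_[liftmnm i u] =
  (\prod_k pvar K (lift i k) ^+ u (lshift n k)) *
  (\prod_k qvar K (lift i k) ^+ u (rshift n k)).
Proof.
rewrite mpolyXE_id big_split_ord /=.
rewrite (@bigD1_ord _ _ _ _ i) // [X in _ * X](@bigD1_ord _ _ _ _ i) //=.
rewrite pqmnmEl pqmnmEr unlift_none !expr0 !mul1r.
by congr (_ * _); apply: eq_bigr => k _; rewrite ?pqmnmEl ?pqmnmEr liftK.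
Qed.

(** The part of [(p_i + p_(i+1))^N] linear in [p_i] is [N p_i p_(i+1)^(N-1)], and [N - 1] is the
    exponent of [p_(i+1)] in the target. The sum has at most one term, and none when [i] is last. *)
Lemma mcoeff_merge_mpolyX n (i : 'I_n.+1) (a b : 'I_n.+1 -> nat) u :
  a i = 1%N -> b i = 0%N ->
  (pqsubst ('X_[u] : pqpoly K n)
     (fun k => (if k == i :> nat then pvar K i else 0) + pvar K (lift i k))
     (fun k => qvar K (lift i k)))@_(pqmnm a b) =
  \sum_(k < n | k == i :> nat)
    (u == pqmnm (fun l => (a (lift i l) + (l == k))%N) (fun l => b (lift i l)))%:R
      *+ (a (lift i k)).+1.
Proof.
move=> ai bi; rewrite /pqsubst comp_mpolyX big_split_ord /=.
under eq_bigr => k _ do rewrite tnth_mktuple (unsplitK (inl k)).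
under [X in _ * X]eq_bigr => k _ do rewrite tnth_mktuple (unsplitK (inr k)).
(* If there is no such [k], then [i] is the last index and the substituted monomial is free of
   [p_i], whereas [pqmnm a b] contains it. *)
have [k0 k0i|no_k] := pickP (fun k : 'I_n => k == i :> nat); last first.
  rewrite [RHS]big_pred0 //.
  transitivity ('X_[liftmnm i u]@_(pqmnm a b) : K).
    rewrite mpolyX_lift; congr ((_ * _)@__); apply: eq_bigr => k _.
    by move: (no_k k) => /= ->; rewrite add0r.
  rewrite mcoeffX; case: eqP => // eq_u.
  by have := pqmnmEl a b i; rewrite -eq_u pqmnmEl unlift_none ai.
have kP (k : 'I_n) : (k == i :> nat) = (k == k0) by rewrite -(eqP k0i).
rewrite [RHS](big_pred1 k0) // (bigD1 k0) //= k0i.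
set N := u (lshift n k0); set Pr := \prod_(k < n | k != k0) _; set Qr := \prod_(k < n) _.
have PrE : Pr = \prod_(k < n | k != k0) pvar K (lift i k) ^+ u (lshift n k).
  by apply: eq_bigr => k /negPf k_neq; rewrite kP k_neq add0r.
have termE (s : nat) : (s <= N)%N ->
    pvar K (lift i k0) ^+ (N - s) * pvar K i ^+ s * Pr * Qr =
    'X_[U_(lshift n.+1 i) *+ s + liftmnm i (u - U_(lshift n k0) *+ s)%MM].
  move=> le_sN; rewrite mpolyXD mpolyX_lift (bigD1 k0) //= mnmBE mulmnE.
  rewrite mnm1E eqxx mul1n -/N [RHS]mulrA [X in _ = X * _]mulrA.
  rewrite -mpolyXn [X in _ = X * _ * _]mulrC.
  congr (_ * _ * _); rewrite ?PrE; apply: eq_bigr => k k_neq; rewrite mnmBE mulmnE mnm1E.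
    by rewrite eq_lshift eq_sym (negPf k_neq) mul0n subn0.
  by rewrite eq_lrshift mul0n subn0.
rewrite addrC exprDn !mulr_suml raddf_sum /=.
pose t := pqmnm (fun l => (a (lift i l) + (l == k0))%N) (fun l => b (lift i l)).
(* Comparing exponents of [p_i] singles out the binomial term [s = 1]. *)
have eq_pqmnm (s : nat) : (s <= N)%N ->
    (U_(lshift n.+1 i) *+ s + liftmnm i (u - U_(lshift n k0) *+ s) == pqmnm a b)%MM
    = (s == 1%N) && (u == t).
  move=> le_sN; apply/eqP/andP => [eq_ab|[/eqP s1 /eqP eq_ut]].
    have s1 : s = 1%N.
      have := pqmnmEl a b i; rewrite -eq_ab mnmDE mulmnE mnm1E eqxx mul1n pqmnmEl.
      by rewrite unlift_none addn0 ai.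
    subst s; split; apply/eqP => //; apply: pqmnmP => k; rewrite ?pqmnmEl ?pqmnmEr.
      have := pqmnmEl a b (lift i k); rewrite -eq_ab mnmDE mulmnE mnm1E pqmnmEl liftK /=.
      rewrite mnmBE mulmnE mnm1E !muln1 !eq_lshift (negPf (neq_lift i k)) add0n.
      by rewrite eq_sym => <-; case: eqP => [->|]; rewrite ?subn0 ?addn0 ?subnK.
    have := pqmnmEr a b (lift i k); rewrite -eq_ab mnmDE mulmnE mnm1E pqmnmEr liftK /=.
    by rewrite mnmBE mulmnE mnm1E !eq_lrshift !mul0n subn0.
  rewrite s1; apply: pqmnmP => j; rewrite mnmDE mnm1E ?pqmnmEl ?pqmnmEr.
    rewrite eq_lshift; case: unliftP => [k ->|->] /=; last by rewrite eqxx.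
    rewrite (negPf (neq_lift i k)) mnmBE mnm1E eq_ut pqmnmEl eq_lshift.
    by rewrite [k0 == k]eq_sym addnK.
  rewrite eq_lrshift; case: unliftP => [k ->|->] //=.
  by rewrite mnmBE mnm1E eq_lrshift subn0 eq_ut pqmnmEr.
transitivity (\sum_(s < N.+1) if s == 1%N :> nat then (u == t)%:R *+ N else 0 : K).
  apply: eq_bigr => s _; have le_sN : (s <= N)%N by rewrite -ltnS.
  rewrite !mulrnAl termE // mcoeffMn mcoeffX eq_pqmnm //.
  by case: eqP => [->|_]; rewrite ?bin1 // mul0rn.
have N_t : u = t -> N = (a (lift i k0)).+1.
  by rewrite /N => ->; rewrite pqmnmEl eqxx addn1.
rewrite -big_mkcond /=; case: eqP => [/N_t ->|_].
  by rewrite (big_pred1 (Ordinal (isT : 1 < (a (lift i k0)).+2)%N)).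
by rewrite mulr0n [RHS]mul0rn big1 // => s _; rewrite mul0rn.
Qed.

Lemma mcoeff_merge n (i : 'I_n.+1) (a b : 'I_n.+1 -> nat) (g : pqpoly K n) :
  a i = 1%N -> b i = 0%N ->
  (pqsubst g
     (fun k => (if k == i :> nat then pvar K i else 0) + pvar K (lift i k))
     (fun k => qvar K (lift i k)))@_(pqmnm a b) =
  \sum_(k < n | k == i :> nat)
    g@_(pqmnm (fun l => (a (lift i l) + (l == k))%N) (fun l => b (lift i l)))
      *+ (a (lift i k)).+1.
Proof.
move=> ai bi; rewrite /pqsubst comp_mpolyEX raddf_sum /=.
under eq_bigr => u _ do
  rewrite mcoeffZ [X in _ * X](mcoeff_merge_mpolyX _ ai bi) mulr_sumr.
rewrite exchange_big; apply: eq_bigr => k _ /=.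
rewrite [in RHS](mpolyE g) raddf_sum -sumrMnl; apply: eq_bigr => u _.
by rewrite /= mcoeffZ mcoeffX mulrnAr.
Qed.

(* The coefficients at the monomials
   [p_1 ... p_m * q_1 ^ (J_1 - 1) ... q_m ^ (J_m - 1)], for [J] of length [m],
   serve as coordinates on [Sol']. *)
Definition comp_mnm m (J : seq nat) : 'X_{1..m + m} :=
  pqmnm (fun _ : 'I_m => 1%N) (fun i : 'I_m => (nth 0%N J i).-1).

(* As [q_i = 0] merges [p_i] and [p_(i+1)], the coefficient of a monomial in
   which [p_i] has exponent [a > 1] is, up to a factor [a], that of a monomial
   where this power is split as [p_i * p_(i+1) ^ (a - 1)]. *)
Lemma mcoeff_full_eq0 (h : pqseq K) : Solq h ->
  (forall J, last_part_gt1 J -> (h (size J))@_(comp_mnm (size J) J) = 0) ->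
  forall m (a b : 'I_m -> nat), (forall i, 0 < a i)%N -> (h m)@_(pqmnm a b) = 0.
Proof.
(* Induction on the total excess of the [a i] over 1, with [m] free because splitting a power adds
   an index. *)
move=> hq hJ m a b; move eqN: (\sum_i (a i).-1)%N => N.
elim: N m a b eqN => [|N IHN] m a b eqN a_gt0.
  have a1 i : a i = 1%N.
    have /eqP := eqN; rewrite sum_nat_eq0 => /forallP /(_ i) /=.
    by case: (a i) (a_gt0 i) => [|[|]].
  (* Here all [a i] are 1. If [m = 0] or the last exponent of [q] is positive, the monomial is one
     of the coordinates; otherwise the equation for [q_m = 0] has a right-hand side free of
     [p_m]. *)
  have [bm_gt0|] := boolP ((m == 0%N) || [exists i : 'I_m, (i.+1 == m) && (0 < b i)%N]).
    pose J := [seq (b i).+1 | i <- enum 'I_m].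
    have sJ : size J = m by rewrite size_map size_enum_ord.
    have nthJ (i : 'I_m) : nth 0%N J i = (b i).+1.
      by rewrite (nth_map i) ?size_enum_ord // nth_ord_enum.
    have hJm : last_part_gt1 J -> (h m)@_(comp_mnm m J) = 0.
      by case: _ / sJ; exact: hJ.
    have -> : pqmnm a b = comp_mnm m J.
      by apply: pqmnmP => i; rewrite ?pqmnmEl ?pqmnmEr ?nthJ ?a1.
    apply: hJm; rewrite /last_part_gt1 /is_composition all_map.
    apply/andP; split; first by apply/allP.
    case/orP: bm_gt0 => [/eqP m0|/existsP[i /andP[/eqP im bi]]].
      by rewrite (size0nil (etrans sJ m0)).
    by rewrite -nth_last sJ -im /= (set_nth_default 0%N) ?sJ ?nthJ.
  case: m a b eqN a_gt0 a1 => [//|n] a b eqN a_gt0 a1.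
  rewrite /= negb_exists => /forallP /(_ ord_max).
  rewrite /= eqxx /= -leqNgt leqn0 => /eqP bmax.
  have := congr1 (mcoeff (pqmnm a b)) (hq n ord_max).
  rewrite pqsubst_q0 mcoeff_kill ?pqmnmEr // mcoeff_merge // big_pred0 // => k.
  by rewrite ltn_eqF.
have [i a_gt1] : exists i, (1 < a i)%N.
  apply/existsP; apply: contra_eqT eqN; rewrite negb_exists => /forallP a_le1.
  rewrite big1 // => i _; have := a_le1 i; rewrite -leqNgt.
  by case: (a i) => [|[]].
(* A new index is inserted just before [i]; it takes one factor of [p_i] and no power of [q]. *)
pose i' := widen_ord (leqnSn m) i.
pose a' j := oapp (fun k => a k - (k == i))%N 1%N (unlift i' j).
pose b' j := oapp b 0%N (unlift i' j).
have a'i : a' i' = 1%N by rewrite /a' unlift_none.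
have b'i : b' i' = 0%N by rewrite /b' unlift_none.
have a'l k : a' (lift i' k) = (a k - (k == i))%N by rewrite /a' liftK.
have := congr1 (mcoeff (pqmnm a' b')) (hq m i').
rewrite pqsubst_q0 mcoeff_kill ?pqmnmEr // mcoeff_merge // (big_pred1 i) //.
rewrite [LHS]IHN; first last.
- move=> j; rewrite /a'; case: unliftP => [k _|_] //=.
  by case: eqP => [->|_]; rewrite ?subn0 // subn_gt0.
- apply/eqP; rewrite -eqSS -eqN; apply/eqP.
  rewrite (@bigD1_ord _ _ _ _ i') //= a'i add0n [RHS](bigD1 i) //=.
  rewrite [in LHS](bigD1 i) //= a'l eqxx subn1 -addSn; congr (_ + _)%N.
    by rewrite prednK // -ltnS prednK.
  by apply: eq_bigr => k /negPf k_neq; rewrite a'l k_neq subn0.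
(* The wanted coefficient appears multiplied by [a i], nonzero in characteristic zero. *)
move/esym/eqP; rewrite mulrn_eq0 => /eqP coef0; rewrite -[RHS]coef0.
congr (_@__); apply: pqmnmP => k; rewrite ?pqmnmEl ?pqmnmEr.
  by rewrite a'l; case: eqP => [->|_]; rewrite ?subn0 ?addn0 // subnK // ltnW.
by rewrite /b' liftK.
Qed.

Lemma Sol_eq0 (h : pqseq K) : Solq h -> Solp h ->
  (forall J, last_part_gt1 J -> (h (size J))@_(comp_mnm (size J) J) = 0) ->
  forall m, h m = 0.
Proof.
move=> hq hp hJ; elim=> [|n IHn].
  apply/mpolyP => u; rewrite mcoeff0.
  have -> : u = pqmnm (fun _ : 'I_0 => 1%N) (fun _ => 1%N) by apply/mnmP => -[].
  exact: mcoeff_full_eq0.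
apply/mpolyP => u; rewrite mcoeff0.
have [/forallP u_gt0|] := boolP [forall i : 'I_n.+1, 0 < u (lshift n.+1 i)]%N.
  have -> : u = pqmnm (fun i => u (lshift n.+1 i)) (fun i => u (rshift n.+1 i)).
    by apply: pqmnmP => i; rewrite ?pqmnmEl ?pqmnmEr.
  exact: mcoeff_full_eq0.
rewrite negb_forall => /existsP[j]; rewrite -eqn0Ngt => /eqP uj.
rewrite -(mcoeff_kill _ uj) -pqsubst_p0 hp IHn.
by rewrite /pqsubst comp_mpoly0 mcoeff0.
Qed.

End Coefficients.

(** * Leading terms of [M_I] *)

Section Triangularity.
Variable K : numFieldType.

Section Avoidance.
Variable m : nat.
Implicit Types (g : pqpoly K m) (s : seq 'I_m) (i j : 'I_m).

(** For [s] the list of all indices, such a [g] has coefficient 0 at every [comp_mnm], since these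
    monomials contain all [p_j]. *)
Definition avoids s g :=
  {in msupp g, forall u : 'X_{1..m + m}, has (fun j => u (lshift m j) == 0%N) s}.

(** [p0 j g = g] serves to say that [g] is free of [p_j]. *)
Definition p0 j g :=
  pqsubst g (fun i => if i == j then 0 else pvar K i) (@qvar K m).

Lemma avoids0 s : avoids s 0.
Proof. by move=> u; rewrite msupp0. Qed.

Lemma avoidsD s g g' : avoids s g -> avoids s g' -> avoids s (g + g').
Proof.
by move=> ag ag' u /msuppD_le; rewrite mem_cat => /orP[/ag|/ag'].
Qed.

Lemma avoids_cons i s g : avoids s g -> avoids (i :: s) g.
Proof. by move=> ag u /ag /= ->; rewrite orbT. Qed.

Lemma p0_msupp j g : p0 j g = g ->
  {in msupp g, forall u : 'X_{1..m + m}, u (lshift m j) = 0%N}.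
Proof.
move=> <- u; apply: contraTeq => uj; rewrite -mcoeff_eq0 /p0 pqsubst_p0.
rewrite comp_mpolyEX raddf_sum /= big1 // => v _; rewrite mcoeffZ comp_mpolyX.
have [vj|vj] := eqVneq (v (lshift m j)) 0%N; last first.
  by rewrite (bigD1 (lshift m j)) //= tnth_mktuple eqxx expr0n (negPf vj) mul0r mcoeff0 mulr0.
have -> : \prod_(l < m + m) tnth [tuple if l' == lshift m j then 0 else 'X_l' |
    l' < m + m] l ^+ v l = 'X_[v] :> pqpoly K m.
  rewrite [RHS]mpolyXE_id; apply: eq_bigr => l _.
  by rewrite tnth_mktuple; case: eqP => // ->; rewrite vj.
rewrite mcoeffX; case: eqP => [vu|_]; last by rewrite mulr0.
by rewrite -vu vj in uj.
Qed.

Lemma avoids_p0 i s g : p0 i g = g -> avoids (i :: s) g.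
Proof. by move=> pg u /(p0_msupp pg) /= ->; rewrite eqxx. Qed.

Lemma avoidsM s g g' :
  {in s, forall j, p0 j g = g} -> avoids s g' -> avoids s (g * g').
Proof.
move=> pg ag' u /msuppM_le /allpairsP[[u1 u2] /= [u1g u2g' ->]].
have /hasP[j js /eqP u2j] := ag' _ u2g'; apply/hasP; exists j => //.
by rewrite mnmDE u2j (p0_msupp (pg j js) u1g).
Qed.

Definition factors s : ncseries (pqpoly K m) :=
  \big[@ncmul K (pqpoly K m)/nc1 (pqpoly K m)]_(i <- s) expfactor K i.

Lemma p0_expfactor i j w : i != j -> p0 j (expfactor K i w) = expfactor K i w.
Proof.
move=> neq_ij; rewrite [LHS]rmorph_expphi; congr (expphi _ _ w).
  by rewrite [LHS]pqsubst_pvar (negPf neq_ij).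
by rewrite [LHS]linear_sum; apply: eq_bigr => l _; rewrite [LHS]pqsubst_qvar.
Qed.

Lemma p0_factors s j w : j \notin s -> p0 j (factors s w) = factors s w.
Proof.
move=> js; rewrite [LHS]rmorph_ncprod; congr (_ w); apply: eq_big_seq => i i_s.
apply/funext => u; apply: p0_expfactor.
by apply: contraNneq js => <-.
Qed.

(** The contribution to [factors s w] in which every factor takes exactly one letter. *)
Fixpoint diag s w : pqpoly K m :=
  match s, w with
  | [::], [::] => 1
  | i :: s', a :: w' => pvar K i * qtail K i ^+ a.-1 * diag s' w'
  | _, _ => 0
  end.

Lemma diag_size s w : size w != size s -> diag s w = 0.
Proof.
elim: s w => [|i s IHs] [|a w] //=; rewrite eqSS => /IHs ->.
by rewrite mulr0.
Qed.

Lemma diag_map s (f : 'I_m -> nat) :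
  diag s (map f s) = \prod_(i <- s) (pvar K i * qtail K i ^+ (f i).-1).
Proof. by elim: s => [|i s IHs] /=; rewrite ?big_nil // big_cons IHs. Qed.

(* A term of the Cauchy product contributes all of [p_i], [i] in [s], only if
   each factor takes at least one letter of [w]. *)
Lemma factors_diag s w : uniq s -> is_composition w -> (size w <= size s)%N ->
  avoids s (factors s w - diag s w).
Proof.
elim: s w => [|i s IHs] w /=.
  by case: w => // _ _ _; rewrite /factors big_nil subrr; apply: avoids0.
move=> /andP[i_s uniq_s]; have pE u : {in s, forall j, p0 j (expfactor K i u) = expfactor K i u}.
  by move=> j js; apply: p0_expfactor; apply: contraNneq i_s => ->.
rewrite /factors big_cons -/(factors s); case: w => [_ _|a w /= /andP[a_gt0 compw]].
  rewrite ncmul_nil [expfactor _ _ _]expphi_nil mul1r subr0.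
  exact/avoids_p0/p0_factors.
rewrite ltnS => le_ws; rewrite ncmul_cons [expfactor _ _ [::]]expphi_nil mul1r -addrA.
(* The split-off term, where the first factor takes no letter, is free of [p_i]. *)
apply: avoidsD; first exact/avoids_p0/p0_factors.
apply: avoids_cons; rewrite /ncmul big_nat_recl //= take0 drop0.
rewrite -[pvar K i * _](@expphi_letter _ _ _ _ a) // -[expphi _ _]/(expfactor K i).
rewrite addrAC -mulrBr; apply: avoidsD; first by apply: avoidsM => //; exact: IHs.
(* When the first factor takes two or more letters, fewer letters than factors remain, so [diag]
   vanishes on the rest. *)
rewrite big_seq; elim/big_ind: _ => [||k]; [exact: avoids0|exact: avoidsD|].
rewrite mem_index_iota => /= lt_kw; apply: avoidsM => //.
rewrite -[factors s _]subr0 -(@diag_size s (drop k.+1 w)).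
  apply: IHs => //; first by apply/allP => x /mem_drop; apply: (allP compw).
  by rewrite size_drop leq_subLR (leq_trans le_ws) // leq_addl.
rewrite size_drop neq_ltn (leq_trans _ le_ws) // ltn_subrL.
by rewrite (leq_ltn_trans _ lt_kw).
Qed.

End Avoidance.

(** Variables of smaller index are larger in the monomial order. *)
Lemma mlead_qtail m (i : 'I_m) : mlead (qtail K i) = U_(rshift m i)%MM.
Proof.
have coefE u : (qtail K i)@_u = \sum_(j < m | (i <= j)%N) (U_(rshift m j)%MM == u)%:R.
  by rewrite raddf_sum; apply: eq_bigr => j _; rewrite /= mcoeffX.
have Ui : (qtail K i)@_U_(rshift m i) = 1.
  rewrite coefE (bigD1 i) //= eqxx big1 ?addr0 // => j /andP[_ /negPf j_neq].
  case: eqP => // /mnmP /(_ (rshift m i)).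
  by rewrite !mnm1E eqxx eq_rshift j_neq.
apply: le_anti; apply/andP; split; last first.
  by apply: msupp_le_mlead; rewrite mcoeff_msupp Ui oner_neq0.
have nz : qtail K i != 0 by apply: contraTneq (oner_neq0 K) => q0; rewrite -Ui q0 mcoeff0 eqxx.
have := mlead_supp nz; rewrite mcoeff_msupp coefE.
have [/existsP[j /andP[le_ij /eqP <-]] _|/existsPn no_j] :=
    boolP [exists j : 'I_m, (i <= j)%N && (U_(rshift m j)%MM == mlead (qtail K i))].
  move: le_ij; rewrite leq_eqVlt => /orP[/eqP/val_inj ->//|lt_ij].
  apply/ltW/ltmcP; rewrite ?mdeg1 //; exists (rshift m i) => [l|].
    rewrite !mnm1E => lt_li; rewrite ![rshift _ _ == l]eq_sym.
    by rewrite -!val_eqE /= !ltn_eqF // (ltn_trans lt_li) //= ltn_add2l.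
  by rewrite !mnm1E eqxx eq_rshift -val_eqE /= gtn_eqF.
rewrite big1 ?eqxx // => j le_ij; have := no_j j.
by rewrite le_ij /= => /negPf ->.
Qed.

Lemma mleadc_qtail m (i : 'I_m) : mleadc (qtail K i) = 1.
Proof.
rewrite mlead_qtail raddf_sum (bigD1 i) //= mcoeffX eqxx big1 ?addr0 // => j.
move=> /andP[_ /negPf j_neq]; rewrite mcoeffX; case: eqP => // /mnmP /(_ (rshift m i)).
by rewrite !mnm1E eqxx eq_rshift j_neq.
Qed.

Lemma diag_prod m I : size I = m -> diag (enum 'I_m) I =
  \prod_(i < m) (pvar K i * qtail K i ^+ (nth 0%N I i).-1).
Proof.
move=> sI; rewrite -[RHS]big_enum -(diag_map (enum 'I_m) (fun i : 'I_m => nth 0%N I i)).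
congr diag; apply: (@eq_from_nth _ 0%N) => [|k]; first by rewrite size_map size_enum_ord.
rewrite sI => lt_km; rewrite (nth_map (Ordinal lt_km)) ?size_enum_ord //.
by rewrite nth_enum_ord.
Qed.

Lemma pvar_neq0 m (i : 'I_m) : pvar K i != 0.
Proof. by rewrite -mleadc_eq0 mleadXm mcoeffX eqxx oner_neq0. Qed.

Lemma qtail_neq0 m (i : 'I_m) : qtail K i != 0.
Proof. by rewrite -mleadc_eq0 mleadc_qtail oner_neq0. Qed.

Lemma mlead_diag m I : size I = m -> mlead (diag (enum 'I_m) I) = comp_mnm m I.
Proof.
move=> sI; rewrite diag_prod // mlead_prod => [|i _ _]; last first.
  by rewrite mulf_neq0 ?expf_neq0 ?pvar_neq0 ?qtail_neq0.
under eq_bigr => i _ do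
  rewrite mleadM ?expf_neq0 ?pvar_neq0 ?qtail_neq0 // mleadXm mleadX ?qtail_neq0 // mlead_qtail.
apply: pqmnmP => j; rewrite mnm_sumE (bigD1 j) //= big1 => [|i /negPf i_neq];
  by rewrite !(mnmDE, mulmnE, mnm1E, pqmnmEl, pqmnmEr, eq_lshift, eq_rshift,
    eq_lrshift, eq_rlshift) ?i_neq ?mul0n // !addn0 ?add0n ?eqxx ?mul1n.
Qed.

Lemma mleadc_diag m I : size I = m -> mleadc (diag (enum 'I_m) I) = 1.
Proof.
move=> sI; rewrite diag_prod // mleadc_prod_proper => [|i _ _]; last first.
  by apply/lregP; rewrite mleadc_eq0 mulf_neq0 ?expf_neq0 ?pvar_neq0 ?qtail_neq0.
rewrite big1 // => i _; rewrite mleadM ?expf_neq0 ?pvar_neq0 ?qtail_neq0 // mleadcM.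
by rewrite mleadXm mcoeffX eqxx mul1r mleadX ?qtail_neq0 // mleadcX mleadc_qtail expr1n.
Qed.

Lemma mcoeff_MY_diag I m J : is_composition I -> (size I <= m)%N ->
  (MY K I m)@_(comp_mnm m J) = (diag (enum 'I_m) I)@_(comp_mnm m J).
Proof.
move=> compI le_Im; apply/eqP; rewrite -subr_eq0 -mcoeffB mcoeff_eq0.
have -> : MY K I m = factors (enum 'I_m) I by rewrite /MY /factors enumT [index_enum _]unlock.
apply/negP => /factors_diag; rewrite enum_uniq size_enum_ord => /(_ isT compI le_Im).
by case/hasP => j _; rewrite pqmnmEl.
Qed.

Lemma mcoeff_MY_short I J m : is_composition I -> (size I < m)%N ->
  (MY K I m)@_(comp_mnm m J) = 0.
Proof.
move=> compI lt_Im; rewrite mcoeff_MY_diag 1?ltnW // diag_size ?mcoeff0 //.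
by rewrite size_enum_ord ltn_eqF.
Qed.

Lemma mcoeff_MY_lt I J m : is_composition I -> size I = m ->
  (comp_mnm m I < comp_mnm m J)%O -> (MY K I m)@_(comp_mnm m J) = 0.
Proof.
move=> compI sI lt_IJ; rewrite mcoeff_MY_diag ?sI //.
by apply: mcoeff_gt_mlead; rewrite mlead_diag.
Qed.

Lemma mcoeff_MY_self I : is_composition I ->
  (MY K I (size I))@_(comp_mnm (size I) I) = 1.
Proof. by move=> compI; rewrite mcoeff_MY_diag // -(mlead_diag (erefl _)) mleadc_diag. Qed.

End Triangularity.

Lemma mdeg_comp_mnm J : is_composition J -> mdeg (comp_mnm (size J) J) = sumn J.
Proof.
move=> compJ; rewrite mdegE big_split_ord /= -big_split /=.
rewrite sumnE (big_nth 0%N) big_mkord; apply: eq_bigr => i _.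
rewrite pqmnmEl pqmnmEr add1n prednK //.
by apply: (allP compJ); apply: mem_nth.
Qed.

Lemma mcoeff_MY_weight (K : numFieldType) I J :
  is_composition J -> sumn I != sumn J -> (MY K I (size J))@_(comp_mnm (size J) J) = 0.
Proof.
move=> compJ neq_IJ; apply: (dhomog_nemf_coeff (MY_dhomog K I (size J))).
by rewrite /= mdeg_comp_mnm // eq_sym.
Qed.

(** * Linear algebra *)

Section SolLinear.
Variable K : numFieldType.

Lemma pqsubst_linear k m (P Q : 'I_k -> pqpoly K m) c f g :
  pqsubst (c *: f + g) P Q = c *: pqsubst f P Q + pqsubst g P Q.
Proof. exact: linearP. Qed.

Lemma Solq_linear c (f g : pqseq K) :
  Solq f -> Solq g -> Solq (fun m => c *: f m + g m).
Proof. by move=> fq gq n i; rewrite !pqsubst_linear fq gq. Qed.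

Lemma Solp_linear c (f g : pqseq K) :
  Solp f -> Solp g -> Solp (fun m => c *: f m + g m).
Proof. by move=> fp gp n i; rewrite !pqsubst_linear fp gp. Qed.

Lemma Sol'_linear c (f g : pqseq K) :
  Sol' f -> Sol' g -> Sol' (fun m => c *: f m + g m).
Proof.
move=> [[[d fd] fs] fq fp] [[[e ge] gs] gq gp]; split; last 2 first.
- exact: Solq_linear.
- exact: Solp_linear.
split=> [|m]; last by rewrite pqsubst_linear fs gs.
exists (maxn d e) => m; apply: leq_trans (msizeD_le _ _) _.
rewrite geq_max !leq_max (leq_trans (msizeZ_le _ _) (fd m)) /=.
by rewrite ge orbT.
Qed.

Lemma Sol'_0 : Sol' (fun m => 0 : pqpoly K m).
Proof.
split=> [|n i|n i]; rewrite /pqsubst ?comp_mpoly0 //.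
by split=> [|m]; [exists 0%N => m; rewrite mmeasure0 | rewrite /pqsubst comp_mpoly0].
Qed.

Lemma Sol'_span (s : seq (seq nat)) (c : seq nat -> K) :
  all last_part_gt1 s -> Sol' (fun m => \sum_(I <- s) c I *: MY K I m).
Proof.
elim: s => [|I s IHs] /=.
  suff -> : (fun m => \sum_(I <- [::]) c I *: MY K I m) = (fun m => 0) by move=> _; apply: Sol'_0.
  by apply: functional_extensionality_dep => m; rewrite big_nil.
move=> /andP[/andP[_ lastI] /IHs Sol_s].
suff -> : (fun m => \sum_(J <- I :: s) c J *: MY K J m) =
    (fun m => c I *: MY K I m + \sum_(J <- s) c J *: MY K J m).
  by apply: Sol'_linear => //; apply: Sol'_MY.
by apply: functional_extensionality_dep => m; rewrite big_cons.
Qed.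

End SolLinear.

Section Triangular.
Variable K : numFieldType.

(** Lexicographic comparison of these lists is comparison by length, then by the monomial order,
    which is itself lexicographic on degree followed by exponents. *)
Definition mnm_key m (J : seq nat) : seq nat :=
  let u := comp_mnm m J in m :: mdeg u :: u.

Definition comp_key (J : seq nat) : seq nat := mnm_key (size J) J.

Definition mcoeff_comp (J : seq nat) (h : pqseq K) : K :=
  (h (size J))@_(comp_mnm (size J) J).

(** The exponents record the predecessors of the parts, which determine the parts because these are
    positive. *)
Lemma comp_key_inj : {in is_composition &, injective comp_key}.
Proof.
move=> I J compI compJ eq_key; have sIJ : size I = size J by case: eq_key.
move: eq_key; rewrite /comp_key sIJ => -[_ eq_val].
have {eq_val}eq_mnm : comp_mnm (size J) I = comp_mnm (size J) J by do 2 apply: val_inj.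
apply: (@eq_from_nth _ 0%N) => // i lt_iI; have lt_iJ : (i < size J)%N by rewrite -sIJ.
have := congr1 (fun u : 'X_{1.. _} => u (rshift _ (Ordinal lt_iJ))) eq_mnm.
rewrite !pqmnmEr /=.
have := allP compI _ (mem_nth 0%N lt_iI); have := allP compJ _ (mem_nth 0%N lt_iJ).
by case: nth => // k _; case: nth => // l _ /= ->.
Qed.

Lemma mcoeff_comp_le I J : is_composition I ->
  mcoeff_comp J (MY K I) != 0 -> (comp_key J <= comp_key I)%O.
Proof.
move=> compI; apply: contraNle => lt_IJ; apply/eqP.
have [lt_size|gt_size|sIJ] := ltngtP (size I) (size J).
- exact: mcoeff_MY_short.
- by move: lt_IJ; rewrite /comp_key ltxi_cons leEnat leqNgt gt_size.
apply: mcoeff_MY_lt => //; move: lt_IJ.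
by rewrite /comp_key sIJ ltxi_cons lexx.
Qed.

Lemma comp_key_max (s : seq (seq nat)) : s != [::] ->
  exists2 I, I \in s & {in s, forall J, (comp_key J <= comp_key I)%O}.
Proof.
elim: s => // I s IHs _; have [->|/IHs[J Js maxJ]] := eqVneq s [::].
  by exists I => [|J]; rewrite mem_seq1 // => /eqP ->.
have [le_JI|/ltW le_IJ] := leP (comp_key J) (comp_key I).
  exists I; first exact: mem_head.
  by move=> L; rewrite inE => /predU1P[->//|/maxJ le_LJ]; apply: le_trans le_JI.
exists J; first by rewrite inE Js orbT.
by move=> L; rewrite inE => /predU1P[->//|/maxJ].
Qed.

Lemma last_part_gt1_comp I : last_part_gt1 I -> is_composition I.
Proof. by case/andP. Qed.

Lemma mcoeff_comp_triangular I J : is_composition I -> is_composition J ->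
  I != J -> (comp_key I <= comp_key J)%O -> mcoeff_comp J (MY K I) = 0.
Proof.
move=> compI compJ neq_IJ le_IJ; apply/eqP; apply: contra_neqT neq_IJ.
move/(mcoeff_comp_le compI) => le_JI.
by apply: comp_key_inj => //; apply: le_anti; rewrite le_IJ.
Qed.

(** At the largest key among the compositions with nonzero coefficient, triangularity leaves a
    single term of the relation. *)
Lemma MY_free (s : seq (seq nat)) (c : seq nat -> K) :
  uniq s -> all last_part_gt1 s ->
  (forall m, \sum_(I <- s) c I *: MY K I m = 0) -> forall I, I \in s -> c I = 0.
Proof.
move=> uniq_s /allP s_gt1 sum0 I0 I0s; apply/eqP; apply: contraT => cI0.
have [|J] := @comp_key_max [seq I <- s | c I != 0].
  by rewrite -has_filter; apply/hasP; exists I0.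
rewrite mem_filter => /andP[cJ Js] maxJ.
have := congr1 (mcoeff (comp_mnm (size J) J)) (sum0 (size J)).
rewrite raddf_sum /= mcoeff0 (bigD1_seq J) //= big1_seq => [|I /andP[neq_IJ Is]].
  rewrite addr0 mcoeffZ mcoeff_MY_self ?last_part_gt1_comp ?s_gt1 // mulr1.
  by move/eqP: cJ.
rewrite mcoeffZ; have [->|cI] := eqVneq (c I) 0; first by rewrite mul0r.
rewrite [_@__]mcoeff_comp_triangular ?mulr0 ?last_part_gt1_comp ?s_gt1 //.
by apply: maxJ; rewrite mem_filter cI.
Qed.

(** Gaussian elimination: subtracting a multiple of [MY K I], for [I] of largest key, kills the
    coordinate [I], and closedness of [s] keeps the coordinates outside [s] zero. Once [s] is empty,
    [Sol_eq0] applies. *)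
Lemma MY_span (s : seq (seq nat)) (h : pqseq K) :
  uniq s -> all last_part_gt1 s ->
  {in s, forall I J, last_part_gt1 J -> mcoeff_comp J (MY K I) != 0 -> J \in s} ->
  Solq h -> Solp h ->
  (forall J, last_part_gt1 J -> J \notin s -> mcoeff_comp J h = 0) ->
  exists c : seq nat -> K, forall m, h m = \sum_(I <- s) c I *: MY K I m.
Proof.
move eqN: (size s) => N; elim: N s h eqN => [|N IHN] s h eqN uniq_s gt1_s closed_s hq hp h0.
  exists (fun=> 0) => m; rewrite (size0nil eqN) big_nil.
  by apply: Sol_eq0 => // J /h0; apply; rewrite (size0nil eqN).
have [|I Is maxI] := @comp_key_max s; first by rewrite -size_eq0 eqN.
have gt1 J : J \in s -> last_part_gt1 J by apply/allP.
have comp J : J \in s -> is_composition J by move/gt1/last_part_gt1_comp.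
have [MYq MYp] : Solq (MY K I) /\ Solp (MY K I).
  by have /andP[_ /Solq_MY] := gt1 I Is; split=> //; apply: Solp_MY.
pose h' m := (- mcoeff_comp I h) *: MY K I m + h m.
have h'E J : mcoeff_comp J h' = mcoeff_comp J h - mcoeff_comp I h * mcoeff_comp J (MY K I).
  by rewrite /mcoeff_comp mcoeffD mcoeffZ mulNr addrC.
have [|||J J_I|||J J_gt1|c' c'E] := IHN (rem I s) h'.
- by rewrite size_rem // eqN.
- exact: rem_uniq.
- by apply/allP => J /mem_rem /gt1.
(* Removing [I] preserves closedness: by maximality of its key, the coordinate [I] vanishes on the
   other [MY K J]. *)
- move=> L L_gt1; rewrite !mem_rem_uniq // !inE.
  move: J_I; rewrite mem_rem_uniq // !inE => /andP[neq_JI Js] L_J.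
  rewrite (closed_s J) // andbT; apply: contraNneq L_J => ->.
  by apply/eqP/mcoeff_comp_triangular; rewrite ?comp ?maxI.
- exact: Solq_linear.
- exact: Solp_linear.
- rewrite mem_rem_uniq // inE negb_and negbK h'E.
  have [->|neq_JI] := eqVneq J I => [_|/= Js].
    by rewrite [X in _ * X]mcoeff_MY_self ?comp // mulr1 subrr.
  rewrite h0 // [X in _ * X](_ : _ = 0) ?mulr0 ?subr0 //.
  by apply: contraNeq Js => /(closed_s I Is J J_gt1).
exists (fun J => if J == I then mcoeff_comp I h else c' J) => m.
rewrite (big_rem I) //= eqxx; have := c'E m; rewrite /h' => /(canRL (addKr _)) ->.
rewrite scaleNr opprK; congr (_ + _); apply: eq_big_seq => J.
by rewrite mem_rem_uniq // inE => /andP[/negPf ->].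
Qed.

End Triangular.

(** * Compositions of bounded weight *)

Fixpoint bounded_words d k : seq (seq nat) :=
  if k is k'.+1 then [::] :: [seq a :: w | a <- iota 1 d, w <- bounded_words d k']
  else [:: [::]].

Lemma mem_bounded_words d k w : is_composition w -> all (leq^~ d) w ->
  (size w <= k)%N -> w \in bounded_words d k.
Proof.
elim: k w => [|k IHk] [|a w] //= /andP[a_gt0 compw] /andP[le_ad le_wd] le_wk.
rewrite inE; apply/allpairsP; exists (a, w); rewrite mem_iota a_gt0 add1n ltnS le_ad.
by split=> //; apply: IHk.
Qed.

(** A composition of weight at most [d] has at most [d] parts, each at most [d]. *)
Lemma finite_compositions d : exists2 s : seq (seq nat), uniq s &
  forall w, (w \in s) = last_part_gt1 w && (sumn w <= d)%N.
Proof.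
exists (undup [seq w <- bounded_words d d | last_part_gt1 w && (sumn w <= d)%N]).
  exact: undup_uniq.
move=> w; rewrite mem_undup mem_filter andb_idr // => /andP[/andP[compw _] le_wd].
have size_le : (size w <= sumn w)%N.
  by elim: w compw {le_wd} => //= a w IHw /andP[a_gt0 /IHw]; rewrite -add1n; apply: leq_add.
apply: mem_bounded_words => //; last exact: leq_trans le_wd.
apply/allP => a a_w; apply: leq_trans le_wd.
by rewrite (perm_sumn (perm_to_rem a_w)) leq_addr.
Qed.

Lemma linear_basis_MY (K : numFieldType) :
  linear_basis last_part_gt1 (@MY K) (@Sol' K).
Proof.
split; first exact: MY_free.
move=> h; split=> [[[[d hd] _] hq hp]|[s [c [gt1_s hE]]]]; last first.
  have -> : h = fun m => \sum_(I <- s) c I *: MY K I m.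
    exact: functional_extensionality_dep.
  exact: Sol'_span.
(* The degree bound of [h] kills its coordinates of weight above [d]; the remaining finite set is
   closed because [MY K I] has nonzero coordinates only in weight [sumn I]. *)
have [s uniq_s sP] := finite_compositions d.
have gt1_s : all last_part_gt1 s by apply/allP => I; rewrite sP => /andP[].
suff [c cE] : exists c : seq nat -> K, forall m, h m = \sum_(I <- s) c I *: MY K I m.
  by exists s, c.
apply: MY_span => // [I + J J_gt1 MY_neq0|J J_gt1].
  rewrite !sP J_gt1 => /andP[_]; suff -> : sumn I = sumn J by [].
  by apply: contraNeq MY_neq0 => /(mcoeff_MY_weight K (last_part_gt1_comp J_gt1)) /eqP.
rewrite sP J_gt1 -ltnNge => /ltnW lt_dJ; apply: memN_msupp_eq0; apply: msize_mdeg_ge.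
by rewrite mdeg_comp_mnm ?last_part_gt1_comp //; apply: leq_trans lt_dJ.
Qed.

Theorem theorem8p1 (R : realType) :
  linear_basis (K := R[i]) last_part_gt1 (@MY R[i]) (@Sol' R[i]).
Proof. exact: linear_basis_MY. Qed.
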